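(* Let $(A,m)$ be a local ring with maximal ideal $m$, and let $E$ be an $A$-module such that $mE=0$. Let $R=A\ltimes E$ be the trivial ring extension of $A$ by $E$. Then: (1) If $A$ is a Noetherian ring which is not a field and $E$ is a finitely generated $A$-module (i.e., $R$ is Noetherian), then $\mathrm{G\text{-}gldim}(R)=\infty$. (2) If $A$ is a perfect ring, then $\mathrm{G\text{-}gldim}(R)$ is either $\infty$ or $0$. Moreover, in the case $\mathrm{G\text{-}gldim}(R)=0$, necessarily $A=K$ is a field and $E$ is a $K$-vector space with $\dim_K E=1$ (i.e., $R=K\ltimes K$).
   Context: All rings are commutative with identity and all modules are unital. ''Local'' means having a unique maximal ideal (not necessarily Noetherian). A ring is perfect if all its flat modules are projective. The trivial ring extension $A\ltimes E$ of a ring $A$ by an $A$-module $E$ is the ring with underlying additive group $A\times E$ and multiplication $(a,e)(a',e')=(aa',ae'+a'e)$. Let $S$ be a ring. An $S$-module $N$ is Gorenstein projective if there is an exact complex $\cdots\to P_1\to P_0\to P^0\to P^1\to\cdots$ of projective $S$-modules with $N\cong\mathrm{Im}(P_0\to P^0)$ that remains exact after applying $\mathrm{Hom}_S(-,Q)$ for every projective $S$-module $Q$. The Gorenstein projective dimension $\mathrm{Gpd}_S(N)$ is the least $n\geq 0$ such that there is an exact sequence $0\to G_n\to\cdots\to G_0\to N\to 0$ with all $G_i$ Gorenstein projective ($\infty$ if there is none). The Gorenstein global dimension of $S$ is $\mathrm{G\text{-}gldim}(S)=\sup\{\mathrm{Gpd}_S(N)\mid N\text{ an }S\text{-module}\}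\in\{0,1,2,\dots\}\cup\{\infty\}$.
   Formalization: The module E is assumed nonzero; for E = 0 one has R = A and the claim fails: part (1) for a discrete valuation ring (G-gldim = 1), part (2) for a field A (G-gldim = 0 but dim E = 0). *)

(* Defs.v *)
From HB Require Import structures.
From mathcomp Require Import all_boot all_algebra.
From mathcomp Require Import boolp classical_sets.

Set Implicit Arguments.
Unset Strict Implicit.
Unset Printing Implicit Defensive.

Import GRing.Theory.
Local Open Scope ring_scope.
Local Open Scope classical_set_scope.

(** * Rings and ideals *)

(* [idealr_closed] describes proper ideals.  Boolean predicates represent
   arbitrary subsets here, by the classical axioms of [boolp]. *)
Definition maximal_ideal (A : comNzRingType) (m : {pred A}) : Prop :=
  idealr_closed m /\
  forall I : {pred A}, idealr_closed I -> {subset m <= I} -> I =i m.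

Definition local_ring (A : comNzRingType) (m : {pred A}) : Prop :=
  maximal_ideal m /\ forall m' : {pred A}, maximal_ideal m' -> m' =i m.

Definition is_field (A : comNzRingType) : Prop :=
  forall a : A, a != 0 -> exists b : A, a * b = 1.

Definition finitely_generated (A : comNzRingType) (E : lmodType A) : Prop :=
  exists (n : nat) (g : 'I_n -> E),
    forall x : E, exists c : 'I_n -> A, x = \sum_(i < n) c i *: g i.

(* Only proper ideals are quantified over; the unit ideal is generated by 1. *)
Definition noetherian (A : comNzRingType) : Prop :=
  forall I : {pred A}, idealr_closed I ->
    exists (n : nat) (g : 'I_n -> A), (forall i, g i \in I) /\
      forall x, x \in I -> exists c : 'I_n -> A, x = \sum_(i < n) c i * g i.

(** * Exactness, projective and flat modules *)

Definition exact (S : comNzRingType) (L M N : lmodType S)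
    (f : {linear L -> M}) (g : {linear M -> N}) : Prop :=
  range f = g @^-1` [set 0].

Definition projective (S : comNzRingType) (P : lmodType S) : Prop :=
  forall (M N : lmodType S) (p : {linear M -> N}) (g : {linear P -> N}),
    range p = setT ->
    exists h : {linear P -> M}, forall x, p (h x) = g x.

(* [b] exhibits [T] as a tensor product of [M] and [N]. *)
Definition tensor_product (S : comNzRingType) (M N T : lmodType S)
    (b : {bilinear M -> N -> T}) : Prop :=
  forall (U : lmodType S) (c : {bilinear M -> N -> U}),
    exists h : {linear T -> U}, (forall x y, h (b x y) = c x y) /\
      forall h' : {linear T -> U},
        (forall x y, h' (b x y) = c x y) -> h' =1 h.

(* [fN] and [gN] are the maps [f (x) N] and [g (x) N]: tensor products being
   unique up to unique isomorphism, all choices of them are considered. *)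
Definition flat (S : comNzRingType) (N : lmodType S) : Prop :=
  forall (M1 M2 M3 : lmodType S) (f : {linear M1 -> M2}) (g : {linear M2 -> M3})
         (T1 T2 T3 : lmodType S) (b1 : {bilinear M1 -> N -> T1})
         (b2 : {bilinear M2 -> N -> T2}) (b3 : {bilinear M3 -> N -> T3})
         (fN : {linear T1 -> T2}) (gN : {linear T2 -> T3}),
    exact f g ->
    tensor_product b1 -> tensor_product b2 -> tensor_product b3 ->
    (forall x y, fN (b1 x y) = b2 (f x) y) ->
    (forall x y, gN (b2 x y) = b3 (g x) y) ->
    exact fN gN.

Definition perfect_ring (S : comNzRingType) : Prop :=
  forall N : lmodType S, flat N -> projective N.

(** * Gorenstein projective modules *)

(* The complex ... -> P_1 -> P_0 -> P^0 -> P^1 -> ... is indexed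
   cohomologically: P_n is [P (- n)] and P^n is [P (n + 1)], so that the map
   P_0 -> P^0 is [d 0].  [iota] identifies [N] with the image of [d 0]. *)
Definition Gorenstein_projective (S : comNzRingType) (N : lmodType S) : Prop :=
  exists (P : int -> lmodType S) (d : forall i : int, {linear P i -> P (i + 1)}),
    [/\ forall i, projective (P i),
        forall i, exact (d i) (d (i + 1)),
        exists iota : {linear N -> P (0 + 1)},
          injective iota /\ range iota = range (d 0)
      & forall (Q : lmodType S), projective Q ->
          forall (i : int) (phi : {linear P (i + 1) -> Q}),
            (forall x, phi (d i x) = 0) <->
            exists psi : {linear P (i + 1 + 1) -> Q},
              forall x, phi x = psi (d (i + 1) x)].

(* An exact sequence 0 -> G_n -> ... -> G_0 -> N -> 0 with all G_i Gorenstein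
   projective, continued to the left by zero modules. *)
Definition Gproj_resolution (S : comNzRingType) (N : lmodType S) (n : nat) : Prop :=
  exists (G : nat -> lmodType S) (d : forall i, {linear G i.+1 -> G i})
         (eps : {linear G 0%N -> N}),
    [/\ forall i, (i <= n)%N -> Gorenstein_projective (G i),
        forall i, (n < i)%N -> forall x : G i, x = 0,
        range eps = setT,
        exact (d 0%N) eps
      & forall i, exact (d i.+1) (d i)].

(** * Gorenstein dimensions, with values in the extended natural numbers *)

Inductive enat : Type := Fin of nat | Infinity.

Definition enat_le (x y : enat) : Prop :=
  match x, y with
  | _, Infinity => True
  | Infinity, Fin _ => False
  | Fin m, Fin n => (m <= n)%N
  end.

Definition least (P : set nat) : enat :=
  match pselect (exists n, `[< P n >]) with
  | left ex => Fin (ex_minn ex)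
  | right _ => Infinity
  end.

Definition Gpd (S : comNzRingType) (N : lmodType S) : enat :=
  least (Gproj_resolution N).

(* The supremum of the [Gpd N] is their least upper bound. *)
Definition Ggldim (S : comNzRingType) : enat :=
  least [set n | forall N : lmodType S, enat_le (Gpd N) (Fin n)].

(** * Trivial ring extensions *)

Section TrivialExtension.
Variables (A : comNzRingType) (E : lmodType A).

Definition triv_ext : Type := (A * E)%type.

HB.instance Definition _ := GRing.Zmodule.on triv_ext.

Definition triv_ext_one : triv_ext := (1, 0).
Definition triv_ext_mul (x y : triv_ext) : triv_ext :=
  (x.1 * y.1, x.1 *: y.2 + y.1 *: x.2).

Fact triv_ext_mulA : associative triv_ext_mul.
Proof.
move=> [a e] [b f] [c g]; rewrite /triv_ext_mul /= mulrA; congr (_, _).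
by rewrite !scalerDr !scalerA addrA (mulrC c a) (mulrC c b).
Qed.

Fact triv_ext_mulC : commutative triv_ext_mul.
Proof.
by move=> [a e] [b f]; rewrite /triv_ext_mul /= mulrC addrC.
Qed.

Fact triv_ext_mul1 : left_id triv_ext_one triv_ext_mul.
Proof.
by move=> [a e]; rewrite /triv_ext_mul /= mul1r scale1r scaler0 addr0.
Qed.

Fact triv_ext_mulDl : left_distributive triv_ext_mul +%R.
Proof.
move=> [a e] [b f] [c g]; rewrite /triv_ext_mul /= mulrDl; congr (_, _).
by rewrite scalerDl scalerDr addrACA.
Qed.

Fact triv_ext_one_neq0 : triv_ext_one != 0.
Proof. by apply/eqP => -[] /eqP; rewrite oner_eq0. Qed.

HB.instance Definition _ := GRing.Zmodule_isComNzRing.Build triv_ext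
  triv_ext_mulA triv_ext_mulC triv_ext_mul1 triv_ext_mulDl triv_ext_one_neq0.

End TrivialExtension.

(* Main.v *)
(* Let x = (0, e) with e <> 0 in E.  The maximal ideal of R is M = m (+) E, and
   the residue field k, embedded in R as R x, is a direct summand of E, hence of
   M.  So Ext^i(k, R) is a summand of Ext^i(M, R) = Ext^{i+1}(k, R).  If
   G-gldim(R) is finite, then Ext^i(-, R) vanishes for large i, and therefore
   Ext^1(k, R) = 0: every map M -> R is the multiplication by an element of R.
   Applied to the projection M -> R x, this forces m = 0 and E = A e.
   Conversely, if A = K is a field and E = K e, every R-module N is Gorenstein
   projective: with eps = x, the maps (a, b) |-> (+-eps a, a +- eps b) on the
   free module K[eps] (x)_K N = N x N form a complete resolution of N. *)
From HB Require Import structures.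
Require Import Defs.
From mathcomp Require Import all_boot all_algebra.
From mathcomp Require Import boolp classical_sets.

Set Implicit Arguments.
Unset Strict Implicit.
Unset Printing Implicit Defensive.

Import GRing.Theory.
Local Open Scope ring_scope.
Local Open Scope classical_set_scope.

(** * Submodules and linear maps *)

(** Maps out of a submodule are total functions on the ambient module, with linearity demanded on
    [S] only; this spares a subtype for each kernel and image. *)
Definition linear_on (R : comNzRingType) (U V : lmodType R) (S : set U)
    (f : U -> V) : Prop :=
  forall a u v, S u -> S v -> f (a *: u + v) = a *: f u + f v.

Definition submodule (R : comNzRingType) (V : lmodType R) (S : set V) : Prop :=
  S 0 /\ forall a u v, S u -> S v -> S (a *: u + v).

Section SubmoduleType.
Variables (R : comNzRingType) (V : lmodType R) (S : set V) (sS : submodule S).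

Definition submodule_pred : {pred V} := fun v => `[< S v >].

Fact submodule_pred_closed : GRing.subsemimod_closed submodule_pred.
Proof.
apply: GRing.submod_closed_semi; case: sS => S0 Slin; split; first exact/asboolP.
by move=> a u v /asboolP Su /asboolP Sv; apply/asboolP/Slin.
Qed.

Definition submodule_sort of submodule S : Type := {v : V | submodule_pred v}.

HB.instance Definition _ := SubChoice.on (submodule_sort sS).
HB.instance Definition _ := GRing.SubChoice_isSubLmodule.Build R V submodule_pred
  (submodule_sort sS) submodule_pred_closed.

Lemma submodule_type :
  exists (W : lmodType R) (i : {linear W -> V}), injective i /\ range i = S.
Proof.
exists (submodule_sort sS), (val : {linear submodule_sort sS -> V}).
split; first exact: val_inj.
apply/seteqP; split=> [_ [w _ <-]|v Sv].
  by have /asboolP := valP w.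
have Pv : submodule_pred v by apply/asboolP.
by exists (Sub v Pv : submodule_sort sS); rewrite ?SubK.
Qed.

End SubmoduleType.

Section Modules.
Variable R : comNzRingType.
Implicit Types U V : lmodType R.

Lemma ex_linear U V (f : U -> V) :
  linear_on setT f -> exists g : {linear U -> V}, g =1 f.
Proof.
move=> lf; have lf' : linear f by move=> a u v; apply: lf.
pose L := GRing.isLinear.Build R U V *:%R f lf'.
pose g : {linear U -> V} := HB.pack f L.
by exists g.
Qed.

(** Two values of one argument differ by a value of [0], so the last hypothesis makes [r] a graph.
    This serves for maps whose values are obtained by choice. *)
Lemma linear_of_relation U V (r : U -> V -> Prop) :
  (forall x, exists y, r x y) ->
  (forall a x x' y y', r x y -> r x' y' -> r (a *: x + x') (a *: y + y')) ->
  (forall y, r 0 y -> y = 0) ->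
  exists f : {linear U -> V}, forall x, r x (f x).
Proof.
move=> rex rlin r0; have [f rf] := choice rex.
have r_fun x y y' : r x y -> r x y' -> y = y'.
  move=> rxy rxy'; apply/eqP; rewrite -subr_eq0; apply/eqP/r0.
  by have := rlin (-1) _ _ _ _ rxy' rxy; rewrite !scaleN1r !addNr addrC.
have [|g gE] := @ex_linear U V f; last by exists g => x; rewrite gE.
by move=> a u v _ _; apply: r_fun (rf _) _; apply: rlin.
Qed.

Lemma submodule_ker U V (f : {linear U -> V}) : submodule [set x | f x = 0].
Proof.
split=> [|a u v] /=; rewrite ?linear0 // linearP => -> ->.
by rewrite scaler0 addr0.
Qed.

Lemma submodule_range U V (f : {linear U -> V}) : submodule (range f).
Proof.
split=> [|a _ _ [u _ <-] [v _ <-]]; first by exists 0; rewrite ?linear0.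
by exists (a *: u + v); rewrite ?linearP.
Qed.

(** Zorn's lemma. With [X] the nonzero vectors of a submodule it yields a complement; with [X] the
    singleton of 1 it yields a maximal ideal. *)
Lemma maximal_submodule V (S : set V) (X : set V) :
  submodule S -> (forall v, S v -> ~ X v) ->
  exists W : set V, [/\ submodule W, S `<=` W,
    forall v, W v -> ~ X v &
    forall v, ~ W v -> exists w a, W w /\ X (w + a *: v)].
Proof.
move=> sS SX.
pose P (W : set V) :=
  W = set0 \/ [/\ submodule W, S `<=` W & forall v, W v -> ~ X v].
have [F FP Ftot|W [PW Wmax]] := @Zorn_bigcup V P.
  have [[W0 FW0 W0n0]|Fall0] := pselect (exists2 W, F W & W <> set0); last first.
    left; rewrite -classical_sets.subset0 => v [W FW Wv].
    by case: Fall0; exists W => // W0; rewrite W0 in Wv.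
  right; have [//|[[W00 _] SW0 _]] := FP _ FW0; split.
  - split=> [|a u v [W1 F1 W1u] [W2 F2 W2v]]; first by exists W0.
    have [W [FW Wu Wv]] : exists W, [/\ F W, W u & W v].
      by have [s12|s21] := Ftot _ _ F1 F2; [exists W2|exists W1]; split; auto.
    have [WE|[[_ Wlin] _ _]] := FP _ FW; first by rewrite WE in Wu.
    by exists W => //; apply: Wlin.
  - by move=> v Sv; exists W0; auto.
  - move=> v [W FW Wv]; have [WE|[_ _ WX]] := FP _ FW; first by rewrite WE in Wv.
    exact: WX.
have {PW} [[W0 Wlin] SW WX] : [/\ submodule W, S `<=` W & forall v, W v -> ~ X v].
  case: PW => // W0; case: (Wmax S); last by right; split.
  rewrite W0 properEneq; split; last exact: sub0set.
  by apply/eqP => S0; have := sS.1; rewrite -S0.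
exists W; split=> // v nWv; apply: contrapT => nex.
pose W' : set V := [set u | exists w a, W w /\ u = w + a *: v].
case: (Wmax W').
  split=> [u Wu|sub]; first by exists u, 0; rewrite scale0r addr0.
  by apply: nWv; apply: sub; exists 0, 1; rewrite scale1r add0r.
right; split.
- split=> [|b _ _ [w [a [Ww ->]]] [w' [a' [Ww' ->]]]].
    by exists 0, 0; rewrite scale0r addr0.
  exists (b *: w + w'), (b * a + a'); split; first exact: Wlin.
  by rewrite scalerDr scalerDl scalerA addrACA.
- by move=> u Su; exists u, 0; rewrite scale0r addr0; split => //; apply: SW.
- by move=> u [w [a [Ww ->]]] Xu; apply: nex; exists w, a.
Qed.

(* The hypothesis holds when [R] is a field, and also when [V] is annihilated
   by a maximal ideal of [R]. *)
Lemma semisimple_projection V (S : set V) :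
  (forall a : R, (forall v : V, a *: v = 0) \/
     exists b, forall v : V, b *: (a *: v) = v) ->
  submodule S ->
  exists p : {linear V -> V}, (forall v, S v -> p v = v) /\ forall v, S (p v).
Proof.
move=> ss [S0 Slin].
have [||W [[W0 Wlin] _ WS Wmax]] :=
    @maximal_submodule V [set 0] [set v | S v /\ v <> 0].
- by split=> // a u v -> ->; rewrite scaler0 addr0.
- by move=> v /= -> [].
have W0S v : W v -> S v -> v = 0.
  by move=> Wv Sv; apply: contrapT => v0; apply: (WS _ Wv).
have [|||p pP] := @linear_of_relation V V (fun v u => S u /\ W (v - u)).
- move=> v; have [Wv|nWv] := pselect (W v).
    by exists 0; rewrite subr0.
  (* Maximality puts a nonzero [w + a *: v] in [S]; so [a] does not kill [V], and undoing [a] splits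
     [v] along [S] and [W]. *)
  have [w [a [Ww [Su u0]]]] := Wmax v nWv; have [av0|[b bav]] := ss a.
    by case: u0; apply: W0S => //; rewrite av0 addr0.
  exists (b *: (w + a *: v)); split.
    by have := Slin b _ _ Su S0; rewrite addr0.
  rewrite scalerDr bav addrC opprD addrNK -scaleNr.
  by have := Wlin (- b) _ _ Ww W0; rewrite addr0.
- move=> a x x' y y' [Sy Wy] [Sy' Wy']; split; first exact: Slin.
  by rewrite opprD addrACA -scalerBr; apply: Wlin.
- move=> u [Su]; rewrite sub0r => Wu; apply: W0S => //.
  by have := Wlin (-1) _ _ Wu W0; rewrite scaleN1r opprK addr0.
exists p; split=> v; last by case: (pP v).
move=> Sv; have [Spv Wv] := pP v.
apply/eqP; rewrite eq_sym -subr_eq0; apply/eqP/W0S => //.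
by have := Slin (-1) _ _ Spv Sv; rewrite scaleN1r addrC.
Qed.

End Modules.

(** * Lifting maps out of projective modules *)

Section Projectives.
Variable R : comNzRingType.
Implicit Types P Q U V Y Z : lmodType R.

Lemma linear_corestrict U V Y (j : {linear V -> Y}) (f : {linear U -> Y}) :
  injective j -> range f `<=` range j ->
  exists g : {linear U -> V}, forall x, j (g x) = f x.
Proof.
move=> j_inj fj; apply: (@linear_of_relation R U V (fun x y => j y = f x)).
- by move=> x; have [|y _ jy] := fj (f x); [exists x | exists y].
- by move=> a x x' y y' e e'; rewrite !linearP e e'.
- by move=> y; rewrite linear0 -(linear0 j) => /j_inj.
Qed.

Lemma projective_lift P Y Z (S : set Y) (p : {linear Y -> Z})
    (g : {linear P -> Z}) :
  projective P -> submodule S -> range g `<=` p @` S ->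
  exists h : {linear P -> Y}, forall x, S (h x) /\ p (h x) = g x.
Proof.
move=> projP sS gS.
have [W [i [i_inj iE]]] := submodule_type sS.
have [T [j [j_inj jE]]] := submodule_type (submodule_range (p \o i)).
have [|q qE] := @linear_corestrict W T Z j (p \o i) j_inj; first by rewrite jE.
have [|g' g'E] := linear_corestrict (f := g) j_inj.
  move=> _ [x _ <-]; rewrite jE; have [|y Sy <-] := gS (g x); first by exists x.
  by move: Sy; rewrite -iE => -[w _ <-]; exists w.
have [|h hE] := projP _ _ q g'.
  apply/seteqP; split=> // t _.
  have : range j (j t) by exists t.
  rewrite jE => -[w _ pw]; exists w => //; apply: j_inj; rewrite qE; exact: pw.
exists (i \o h) => x; split; first by rewrite -iE; exists (h x).
by rewrite -[RHS]g'E -hE qE.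
Qed.

Lemma projective_regular : projective (R^o : lmodType R).
Proof.
move=> M N p g pT; have [y _ py] : range p (g 1) by rewrite pT.
have [|h hE] := @ex_linear R R^o M (fun a => a *: y).
  by move=> a u v _ _; rewrite scalerDl scalerA.
by exists h => x; rewrite hE linearZ py -linearZ; congr (g _); apply: mulr1.
Qed.

Lemma projective_zero P : (forall x : P, x = 0) -> projective P.
Proof.
move=> P0 M N p g _; exists \0 => x.
by rewrite (P0 x) !linear0.
Qed.

Lemma projective_prod P Q : projective P -> projective Q ->
  projective (P * Q : lmodType R)%type.
Proof.
move=> projP projQ M N p g pT.
have pair_lin a (u v : P) (x y : Q) :
  (a *: u + v, a *: x + y) = a *: (u, x) + (v, y) by [].
have [|gP gPE] := @ex_linear R P N (fun x => g (x, 0)).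
  by move=> a u v _ _; rewrite -linearP -pair_lin scaler0 addr0.
have [|gQ gQE] := @ex_linear R Q N (fun x => g (0, x)).
  by move=> a u v _ _; rewrite -linearP -pair_lin scaler0 addr0.
have [hP hPE] := projP M N p gP pT.
have [hQ hQE] := projQ M N p gQ pT.
have [|h hE] := @ex_linear R (P * Q)%type M (fun x => hP x.1 + hQ x.2).
  by move=> a u v _ _; rewrite !linearP scalerDr addrACA.
exists h => -[x y]; rewrite hE linearD hPE hQE gPE gQE -linearD.
by congr (g (_, _)); rewrite ?addr0 ?add0r.
Qed.

End Projectives.


(** * Vanishing of Ext(-, R) *)

(* For [i > 0] this expresses that Ext^i_R(S, R) = 0, whereas [Ext_vanish 0 S]
   says that the restriction map Hom(Y, R) -> Hom(S, R) is onto. *)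
Fixpoint Ext_vanish (R : comNzRingType) (i : nat) (Y : lmodType R) (S : set Y)
    : Prop :=
  match i with
  | 0 => forall theta : Y -> R^o, linear_on S theta ->
      exists psi : {linear Y -> R^o}, forall y, S y -> psi y = theta y
  | i'.+1 => exists (P : lmodType R) (d : {linear P -> Y}),
      [/\ projective P, range d = S & Ext_vanish i' [set x | d x = 0]]
  end.

Section ExtVanish.
Variable R : comNzRingType.
Implicit Types P U V Y Z : lmodType R.

Lemma Ext_vanish_retract i Y Z (f : {linear Y -> Z}) (r : {linear Z -> Y})
    (S : set Y) :
  cancel f r -> Ext_vanish i S -> Ext_vanish i (f @` S).
Proof.
case: i => [|i] fK.
  move=> ext theta lin_theta; have [a u v Su Sv|psi psiE] := ext (theta \o f).
    by rewrite /= linearP; apply: lin_theta; [exists u | exists v].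
  by exists (psi \o r) => _ [y Sy <-]; rewrite /= fK psiE.
case=> P [d [projP dS ext]]; exists P, (f \o d); split=> //.
  by rewrite -dS image_comp.
suff -> : [set x | (f \o d) x = 0] = [set x | d x = 0] by [].
apply/seteqP; split=> x /=; last by move->; rewrite linear0.
by rewrite -(linear0 f) => /(can_inj fK).
Qed.

Lemma Ext_vanish_inj i Y Z (f : {linear Y -> Z}) (S : set Y) :
  injective f -> Ext_vanish i.+1 (f @` S) -> Ext_vanish i.+1 S.
Proof.
move=> f_inj [P [d [projP dS ext]]].
have [|d' d'E] := linear_corestrict (f := d) f_inj.
  by rewrite dS => _ [x _ <-]; exists x.
exists P, d'; split=> //.
  apply/seteqP; split=> [_ [x _ <-]|y Sy].
    have : range d (d x) by exists x.
    by rewrite dS -d'E => -[y Sy /f_inj <-].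
  have : (f @` S) (f y) by exists y.
  by rewrite -dS => -[x _]; rewrite -d'E => /f_inj <-; exists x.
suff -> : [set x | d' x = 0] = [set x | d x = 0] by [].
apply/seteqP; split=> x /=; rewrite -d'E; first by move->; rewrite linear0.
by rewrite -(linear0 f) => /f_inj.
Qed.

Lemma Ext_vanish0 i Y : Ext_vanish i [set 0 : Y].
Proof.
pose Z : lmodType R := 'rV[R]_0.
have Z0 (x : Z) : x = 0 by apply/rowP => -[].
elim: i Y => [|i IHi] Y.
  move=> theta lin_theta; exists \0 => x ->.
  have := lin_theta (-1) 0 0 erefl erefl.
  by rewrite scaler0 addr0 scaleN1r addNr.
exists Z, \0; split; first exact: projective_zero.
  by apply/seteqP; split=> [_ [x _ <-] //|_ ->]; exists 0.
suff -> : [set x : Z | (\0%R : {linear Z -> Y}) x = 0] = [set 0] by apply: IHi.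
by apply/seteqP; split=> x //= _; rewrite (Z0 x).
Qed.

Lemma Ext_vanish_zero i Z : (forall x : Z, x = 0) -> Ext_vanish i [set: Z].
Proof.
move=> Z0; suff -> : [set: Z] = [set 0] by apply: Ext_vanish0.
by apply/seteqP; split=> x //= _; rewrite (Z0 x).
Qed.

(* Exactness of Ext^i(p(S), R) -> Ext^i(S, R) -> Ext^i(S n Ker p, R) in the
   middle, by the horseshoe lemma. *)
Lemma Ext_vanish_extension i Y Z (p : {linear Y -> Z}) (S : set Y) :
  submodule S ->
  Ext_vanish i (S `&` [set x | p x = 0]) -> Ext_vanish i (p @` S) ->
  Ext_vanish i S.
Proof.
elim: i Y Z p S => [|i IHi] Y Z p S [S0 Slin].
  move=> ext1 ext2 theta lin_theta.
  have [a u v [Su _] [Sv _]|psi1 psi1E] := ext1 theta; first exact: lin_theta.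
  (* The section [s] need not be linear: [theta - psi1] vanishes on the part of [S] killed by [p],
     so its value at [s z] depends on [z] only. *)
  have /choice[s sP] z : exists y, (p @` S) z -> S y /\ p y = z.
    have [[y Sy yz]|nz] := pselect ((p @` S) z); first by exists y.
    by exists 0.
  have theta0 : theta 0 = 0.
    have := lin_theta (-1) 0 0 S0 S0.
    by rewrite scaler0 addr0 scaleN1r addNr.
  have thetaB y y' : S y -> S y' -> p y = p y' ->
      theta y - psi1 y = theta y' - psi1 y'.
    move=> Sy Sy' yy'; have := psi1E ((-1) *: y + y').
    rewrite linearP lin_theta // => e.
    have {}e : -1 *: psi1 y + psi1 y' = -1 *: theta y + theta y'.
      apply: e; split; first exact: Slin.
      by rewrite /= linearP yy' scaleN1r addNr.
    rewrite !scaleN1r in e.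
    by apply: (addrI (- theta y)); rewrite addKr addrA -e addrK.
  have [|psi2 psi2E] := ext2 (fun z => theta (s z) - psi1 (s z)).
    move=> a u v Su Sv; have [Ssu psu] := sP _ Su; have [Ssv psv] := sP _ Sv.
    have Suv : S (a *: s u + s v) by apply: Slin.
    have puv : p (a *: s u + s v) = a *: u + v by rewrite linearP psu psv.
    have [|Ss ps] := sP (a *: u + v); first by exists (a *: s u + s v).
    rewrite (@thetaB _ (a *: s u + s v)) // ?ps ?puv // lin_theta // linearP.
    by rewrite scalerBr opprD addrACA.
  exists (psi1 \+ (psi2 \o p)) => y Sy.
  have pSy : (p @` S) (p y) by exists y.
  have [Ss ps] := sP _ pSy.
  by rewrite /= psi2E // (@thetaB _ y) // addrC subrK.
move=> [P1 [d1 [projP1 d1E ext1]]] [P2 [d2 [projP2 d2E ext2]]].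
have [//||h hE] := @projective_lift R P2 Y Z S p d2 projP2; first by rewrite d2E.
have [|d dE] := @ex_linear R (P1 * P2)%type Y (fun x => d1 x.1 + h x.2).
  by move=> a u v _ _; rewrite !linearP scalerDr addrACA.
have [|inl inlE] := @ex_linear R P1 (P1 * P2)%type (fun x => (x, 0)).
  by move=> a u v _ _; apply: injective_projections; rewrite /= ?scaler0 ?addr0.
have d1S x : S (d1 x) /\ p (d1 x) = 0.
  by have : range d1 (d1 x) by [exists x]; rewrite d1E.
have pd x : p (d x) = d2 x.2 by rewrite dE linearD (d1S _).2 add0r (hE _).2.
exists (P1 * P2 : lmodType R)%type, d; split; first exact: projective_prod.
  apply/seteqP; split=> [_ [x _ <-]|y Sy].
    by rewrite dE -[d1 _]scale1r; apply: Slin; [exact: (d1S _).1|exact: (hE _).1].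
  have : (p @` S) (p y) by exists y.
  rewrite -d2E => -[x2 _ x2y].
  have : (S `&` [set x | p x = 0]) (y - h x2).
    split; last by rewrite /= linearB (hE _).2 x2y subrr.
    by rewrite addrC -scaleN1r; apply: Slin => //; exact: (hE _).1.
  rewrite -d1E => -[x1 _ x1y]; exists (x1, x2) => //.
  by rewrite dE /= x1y addrNK.
(* By the second projection, the kernel of [d] is an extension of the kernel of [d2] by that of
   [d1]. *)
apply: (IHi _ _ snd); first exact: submodule_ker.
  suff -> : [set x | d x = 0] `&` [set x | snd x = 0] = inl @` [set x | d1 x = 0].
    by apply: (@Ext_vanish_retract _ _ _ _ fst) ext1 => x; rewrite inlE.
  apply/seteqP; split=> [[x y] /= []|_ [x /= x0 <-]].
    by rewrite dE /= => + y0; rewrite y0 linear0 addr0 => d0;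
      exists x; rewrite ?inlE.
  by rewrite dE inlE /= x0 linear0 addr0.
suff -> : snd @` [set x | d x = 0] = [set x | d2 x = 0] by [].
apply/seteqP; split=> [_ [x /= x0 <-]|y /= y0]; first by rewrite -pd x0 linear0.
have : (S `&` [set x | p x = 0]) (h y).
  by split; [exact: (hE _).1 | rewrite /= (hE _).2].
rewrite -d1E => -[x _ xy]; exists (- x, y) => //=.
by rewrite dE /= linearN xy addNr.
Qed.

End ExtVanish.

(** * Gorenstein projective resolutions and Ext *)

Section GorensteinExt.
Variable R : comNzRingType.
Implicit Types N P Y Z : lmodType R.

(** Dimension shifting: a cover [d] of [S] followed by [p] covers the image of [S], and [d] maps the
    kernel of [p \o d] onto the part of [S] killed by [p], with kernel that of [d]. *)
Lemma Ext_vanish_shift i Y Z (p : {linear Y -> Z}) (S : set Y) :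
  Ext_vanish i.+1 S -> Ext_vanish i (S `&` [set x | p x = 0]) ->
  Ext_vanish i.+1 (p @` S).
Proof.
move=> [P [d [projP dS extS]]] extK; exists P, (p \o d); split=> //.
  by rewrite -dS image_comp.
apply: (Ext_vanish_extension (p := d)); first exact: submodule_ker.
  suff -> : [set x | (p \o d) x = 0] `&` [set x | d x = 0] = [set x | d x = 0] by [].
  by apply/seteqP; split=> [x []|x /= d0] //; rewrite d0 linear0.
suff -> : d @` [set x | (p \o d) x = 0] = S `&` [set x | p x = 0] by [].
rewrite -dS; apply/seteqP; split=> [_ [x /= x0 <-]|_ [[x _ <-] x0]].
  by split=> //; exists x.
by exists x.
Qed.

(** The left half of a complete resolution is a projective resolution of [N], and stays exact under
    Hom(-, R). *)
Lemma Ext_vanish_Gorenstein_projective i N :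
  Gorenstein_projective N -> Ext_vanish i.+1 [set: N].
Proof.
case=> P [d [projP exd [iota [iota_inj iotaE]] homd]].
suff ext : forall j, Ext_vanish i.+1 (range (d j)).
  by apply: (Ext_vanish_inj iota_inj); rewrite iotaE.
suff ext k j : Ext_vanish k (range (d j)) by move=> j; apply: ext.
(* Indices are written as successors because exactness and Hom-exactness are stated at
   [d (i + 1)]. *)
have [j' ->] : exists j', j = j' + 1 by exists (j - 1); rewrite subrK.
elim: k j' {j} => [|k IHk] j.
  move=> theta lin_theta.
  (* Pulled back to [P (j + 1)], [theta] kills the image of [d j], so it factors through
     [d (j + 1)]; the factor is the desired extension. *)
  have [|phi phiE] := @ex_linear R (P (j + 1)) R^o (theta \o d (j + 1)).
    by move=> a u v _ _; rewrite /= linearP; apply: lin_theta; [exists u|exists v].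
  have [phi0 _] := homd R^o (@projective_regular R) j phi.
  have [|psi psiE] := phi0.
    move=> x; rewrite phiE /=.
    have -> : d (j + 1) (d j x) = 0.
      have : range (d j) (d j x) by exists x.
      by rewrite (exd j).
    have := lin_theta (-1) 0 0; rewrite scaler0 addr0 scaleN1r addNr; apply.
      by exists 0; rewrite ?linear0.
    by exists 0; rewrite ?linear0.
  by exists psi => _ [x _ <-]; rewrite -psiE phiE.
exists (P (j + 1)), (d (j + 1)); split=> //.
have [j' jE] : exists j', j = j' + 1 by exists (j - 1); rewrite subrK.
by have := IHk j'; rewrite -jE exd.
Qed.

Lemma Ext_vanish_Gproj_resolution n N :
  Gproj_resolution N n -> Ext_vanish n.+1 [set: N].
Proof.
case=> G [d [eps [GP G0 epsT ex_eps exd]]].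
(* The image of [d j] is the syzygy of order [j + 1], whose Ext vanishes from degree [n - j] on. The
   induction starts with [n <= j], where [G j.+1] is zero. *)
suff ext t j : (n <= t + j)%N -> Ext_vanish t (range (d j)).
  rewrite -epsT; apply: Ext_vanish_shift.
    exact: Ext_vanish_Gorenstein_projective (GP 0 (leq0n n)).
  by have := ext n 0 (leq_addr 0 n); rewrite ex_eps setTI.
elim: t j => [|t IHt] j le_n.
  suff -> : range (d j) = [set 0] by apply: Ext_vanish0.
  apply/seteqP; split=> [_ [x _ <-]|_ ->]; last by exists 0; rewrite ?linear0.
  by rewrite /= (G0 j.+1 le_n x) linear0.
apply: Ext_vanish_shift; last first.
  by have := IHt j.+1; rewrite addnS setTI exd; apply.
have [lejn|ltnj] := leqP j.+1 n; last exact: Ext_vanish_zero (G0 _ ltnj).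
exact: Ext_vanish_Gorenstein_projective (GP _ lejn).
Qed.

End GorensteinExt.

Lemma least_Fin (P : set nat) n : least P = Fin n -> P n.
Proof.
rewrite /least; case: pselect => // ex [<-].
by case: ex_minnP => m /asboolP.
Qed.

Lemma least_le (P : set nat) n : P n -> enat_le (least P) (Fin n).
Proof.
move=> Pn; rewrite /least; case: pselect => [ex|[]] /=; last first.
  by exists n; apply/asboolP.
by case: ex_minnP => m _ /(_ n); apply; apply/asboolP.
Qed.

Lemma Ggldim_Gproj_resolution (S : comNzRingType) n (N : lmodType S) :
  Ggldim S = Fin n -> exists m, Gproj_resolution N m.
Proof.
move=> /least_Fin /(_ N); rewrite /Gpd.
by case E : least => [m|] // _; exists m; apply: least_Fin.
Qed.

(** * Trivial extensions of finite Gorenstein global dimension *)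

(** The multiples of a nonunit avoid 1, so Zorn's lemma puts them in a maximal ideal, which is [m]
    by uniqueness. *)
Lemma local_unit (A : comNzRingType) (m : {pred A}) (a : A) :
  local_ring m -> a \notin m -> exists b, b * a = 1.
Proof.
move=> [_ m_uniq] am; apply: contrapT => a_nonunit.
pose S : set A^o := [set x | exists b, x = b * a].
have [||W [[W0 Wlin] SW W1 Wmax]] := @maximal_submodule A A^o S [set 1].
- split=> [|c _ _ [b ->] [b' ->]]; first by exists 0; rewrite mul0r.
  by exists (c * b + b'); rewrite mulrDl -mulrA.
- by move=> _ [b ->] /= ba; apply: a_nonunit; exists b.
pose w : {pred A} := fun x => `[< W x >].
have wmax : maximal_ideal w.
  split.
    split; [exact/asboolP | by apply/negP => /asboolP/W1; apply | ].
    by move=> b u v /asboolP Wu /asboolP Wv; apply/asboolP/Wlin.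
  move=> I [I0 I1 Ilin] wI x; apply/idP/idP; last by move/wI.
  move=> Ix; apply/asboolP; apply: contrapT => nWx.
  have [u [b [Wu ub]]] := Wmax x nWx.
  have Iu : u \in I by apply: wI; apply/asboolP.
  by move/negP: I1; apply; rewrite -ub addrC; apply: Ilin.
move/negP: am; apply; rewrite -(m_uniq _ wmax); apply/asboolP/SW.
by exists 1; rewrite mul1r.
Qed.

Section FiniteDimension.
Variables (A : comNzRingType) (m : {pred A}) (E : lmodType A).
Hypothesis A_local : local_ring m.
Hypothesis mE0 : forall (a : A) (v : E), a \in m -> a *: v = 0.
Variable e : E.
Hypothesis e_neq0 : e != 0.
Variable pi : {linear E -> E}.
Hypothesis pi_e : pi e = e.
Hypothesis pi_line : forall v, exists c, pi v = c *: e.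

Local Notation R := (triv_ext E).

Lemma scale_eq0_mem (a : A) : a *: e = 0 -> a \in m.
Proof.
move=> ae0; apply: contrapT => /negP/(local_unit A_local)[b ba].
by case/eqP: e_neq0; rewrite -[e]scale1r -ba -scalerA ae0 scaler0.
Qed.

Definition rho (r : R) : R^o := ((0, pi r.2) : R).

(* The maximal ideal of [R] is the direct sum of the [R]-modules [m] and [E];
   [rho] is its projection onto the line generated by [e]. *)
Lemma linear_on_rho : linear_on (fun r : R^o => (r : R).1 \in m) rho.
Proof.
move=> [a f] [b g] [c h] /= bm _; apply: injective_projections => /=.
  by rewrite mulr0 addr0.
by rewrite !linearD linearZ /= (mE0 f bm) linear0 addr0 scale0r addr0.
Qed.

(* The residue field of [R], which is the submodule generated by [(0, e)], is
   a direct summand of [S]. *)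
Definition has_residue_summand (Y : lmodType R) (S : set Y) : Prop :=
  exists (y : Y) (c : Y -> R^o),
    [/\ S y, forall r : R, r.1 \in m -> r *: y = 0, linear_on S c,
        forall z, S z -> exists t : A, c z = ((0, t *: e) : R) & c y != 0].

(** As [P] is projective, [c \o d] lifts along the multiplication by [(0, e)] to a map [b]. The
    residue class of [b x] determines [c (d x)]: it is zero on the kernel of [d], and nonzero at a
    preimage [q] of [y]. *)
Lemma residue_summand_cover i (Y : lmodType R) (S : set Y) :
  Ext_vanish i.+1 S -> has_residue_summand S ->
  exists (P : lmodType R) (d : {linear P -> Y}) (b : {linear P -> R^o}) (q : P),
    [/\ Ext_vanish i [set x | d x = 0],
        forall x, d x = 0 -> (b x : R).1 \in m,
        forall r : R, r.1 \in m -> d (r *: q) = 0 & (b q : R).1 \notin m].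
Proof.
move=> [P [d [projP dS ext]]] [y [c [Sy My lin_c c_line cy]]].
have Sd x : S (d x) by rewrite -dS; exists x.
have [|g gE] := @ex_linear R P R^o (c \o d).
  by move=> a u v _ _; rewrite /= linearP; apply: lin_c; apply: Sd.
have [|x0 x0E] := @ex_linear R R^o R^o (fun r => r * ((0, e) : R)).
  by move=> a u v _ _; rewrite mulrDl -mulrA.
have [||b bE] := @projective_lift R P R^o R^o setT x0 g projP.
- by split.
- move=> _ [x _ <-]; have [t ct] := c_line _ (Sd x); exists ((t, 0) : R) => //.
  rewrite x0E gE /= ct; apply: injective_projections => /=.
    by rewrite mulr0.
  by rewrite scaler0 addr0.
have {}bE x : c (d x) = ((0, (b x : R).1 *: e) : R).
  have [_] := bE x; rewrite x0E gE => /= <-.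
  by apply: injective_projections => /=; rewrite ?mulr0 ?scale0r ?addr0.
move: Sy; rewrite -dS => -[q _ qy].
exists P, d, b, q; split=> //.
- move=> x dx0; apply: scale_eq0_mem.
  have := bE x; rewrite dx0.
  have -> : c 0 = 0.
    have S0 : S 0 by rewrite -(linear0 d).
    have := lin_c (-1) 0 0 S0 S0.
    by rewrite scaler0 addr0 scaleN1r addNr.
  by case.
- by move=> r rm; rewrite linearZ qy; apply: My.
- by apply/negP => bm; case/eqP: cy; rewrite -qy bE mE0.
Qed.

Lemma rho_line (r : R) : exists t : A, rho r = ((0, t *: e) : R).
Proof. by have [t pit] := pi_line r.2; exists t; rewrite /rho pit. Qed.

(** The summand is generated by [(0, e) *: q], which [rho \o b] sends to [(0, (b q).1 *: e)],
    nonzero because [(b q).1] is a unit. *)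
Lemma residue_summand_syzygy (P Y : lmodType R) (d : {linear P -> Y})
    (b : {linear P -> R^o}) (q : P) :
  (forall x, d x = 0 -> (b x : R).1 \in m) ->
  (forall r : R, r.1 \in m -> d (r *: q) = 0) -> (b q : R).1 \notin m ->
  has_residue_summand [set x | d x = 0].
Proof.
move=> bm Mq bq; have m0 : 0 \in m by case: A_local => -[[]].
exists (((0, e) : R) *: q), (rho \o b); split.
- exact: Mq.
- move=> r rm; rewrite scalerA.
  suff -> : r * ((0, e) : R) = 0 by rewrite scale0r.
  by apply: injective_projections; rewrite /= ?mulr0 // mE0 // scale0r addr0.
- move=> a u v u0 v0; rewrite /= linearP; apply: linear_on_rho; exact: bm.
- by move=> z _; apply: rho_line.
- apply/negP => /eqP; rewrite /= linearZ => -[] /=.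
  rewrite scale0r add0r linearZ /= pi_e => /scale_eq0_mem.
  by apply/negP.
Qed.

(** Syzygies bring the degree down to 1. There [rho \o b] extends from the kernel of [d] to a map
    [psi] on [P], and the two are compared on the multiples of [q] by the maximal ideal. *)
Lemma residue_summand_rigid i (Y : lmodType R) (S : set Y) :
  Ext_vanish i.+1 S -> has_residue_summand S ->
  is_field A /\ forall v : E, exists c, v = c *: e.
Proof.
elim: i Y S => [|i IHi] Y S ext sumS; last first.
  have [P [d [b [q [extK bm Mq bq]]]]] := residue_summand_cover ext sumS.
  exact: IHi extK (residue_summand_syzygy bm Mq bq).
have [P [d [b [q [extK bm Mq bq]]]]] := residue_summand_cover ext sumS.
have m0 : 0 \in m by case: A_local => -[[]].
have [|psi psiE] := extK (rho \o b).
  by move=> a u v u0 v0; rewrite /= linearP; apply: linear_on_rho; exact: bm.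
have {}psiE (r : R) : r.1 \in m -> rho (r * (b q : R)) = r * (psi q : R).
  by move=> rm; have := psiE _ (Mq _ rm); rewrite /= !linearZ.
set s := (b q : R).1 in bq; set t := (psi q : R).1.
(* Second components of [psiE] at [r = (0, v)]. *)
have piE v : pi (s *: v) = t *: v.
  have := psiE (0, v) m0; rewrite /rho /= => -[_].
  by rewrite !scale0r !add0r.
have tm : t \notin m.
  apply/negP => tm; move/negP: bq; apply; apply: scale_eq0_mem.
  by have := piE e; rewrite linearZ /= pi_e => ->; rewrite mE0.
have [t' tK] := local_unit A_local tm.
(* At [r = (a, 0)] the first component of [rho] is 0, so [a * t = 0] with [t] a unit. *)
have m_eq0 a : a \in m -> a = 0.
  move=> am; have := psiE (a, 0) am; rewrite /rho /= => -[/esym at0 _].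
  by rewrite -[a]mulr1 -tK mulrCA at0 mulr0.
split=> [a a0|v].
  have [|b' ba] := @local_unit _ _ a A_local.
    by apply: contra a0 => /m_eq0/eqP.
  by exists b'; rewrite mulrC.
have [c pic] := pi_line (s *: v); exists (t' * c).
by rewrite -scalerA -pic piE scalerA tK scale1r.
Qed.

Lemma finite_Ggldim_rigid n :
  Ggldim R = Fin n -> is_field A /\ forall v : E, exists c, v = c *: e.
Proof.
(* The descent starts from the line [S] generated by [(0, e)], a copy of the residue field, with its
   inclusion in R as the map [c]. *)
move=> finR; pose S : set R^o := [set r | exists c : A, r = ((0, c *: e) : R)].
have sS : submodule S.
  split=> [|[a f] _ _ [c ->] [c' ->]]; first by exists 0; rewrite scale0r.
  exists (a * c + c'); apply: injective_projections => /=.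
    by rewrite mulr0 addr0.
  by rewrite scale0r addr0 scalerA scalerDl.
have [N [i [i_inj iE]]] := submodule_type sS.
have [k resN] := Ggldim_Gproj_resolution N finR.
apply: (residue_summand_rigid (Ext_vanish_Gproj_resolution resN)).
have [y _ iy] : range i ((0, e) : R) by rewrite iE; exists 1; rewrite scale1r.
exists y, i; split=> //.
- move=> r rm; apply: i_inj; rewrite linearZ iy linear0.
  by apply: injective_projections; rewrite /= ?mulr0 // mE0 // scale0r addr0.
- by move=> a u v _ _; rewrite linearP.
- by move=> z _; have : range i (i z) by [exists z]; rewrite iE.
- by rewrite iy; apply: contra e_neq0 => /eqP[->].
Qed.

End FiniteDimension.

(** * Extending and lifting linear maps over a field *)

Section VectorSpaces.
Variable K : comNzRingType.
Hypothesis K_field : is_field K.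
Implicit Types X Y Z : lmodType K.

Lemma field_projection X (S : set X) : submodule S ->
  exists p : {linear X -> X}, (forall v, S v -> p v = v) /\ forall v, S (p v).
Proof.
apply: semisimple_projection => a; have [->|a0] := eqVneq a 0.
  by left=> v; rewrite scale0r.
have [b ab] := K_field a0; right; exists b => v.
by rewrite scalerA mulrC ab scale1r.
Qed.

Lemma field_extension X Y Z (f : {linear X -> Y}) (g : {linear X -> Z}) :
  (forall x, f x = 0 -> g x = 0) ->
  exists h : {linear Y -> Z}, forall x, h (f x) = g x.
Proof.
move=> fg; have [p [pf f_p]] := field_projection (submodule_range f).
have [|||h hE] := @linear_of_relation K Y Z
  (fun y z => exists x, f x = p y /\ g x = z).
- by move=> y; have [x _ xy] := f_p y; exists (g x), x.
- move=> a y y' _ _ [x [xy <-]] [x' [xy' <-]]; exists (a *: x + x').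
  by rewrite !linearP xy xy'.
- by move=> z [x []]; rewrite linear0 => /fg -> <-.
exists h => x; have [x' [x'E <-]] := hE (f x).
apply/eqP; rewrite -subr_eq0 -linearB fg //.
by rewrite linearB x'E pf ?subrr //; exists x.
Qed.

Lemma field_lift X Y Z (f : {linear X -> Y}) (g : {linear Z -> Y}) :
  range g `<=` range f -> exists h : {linear Z -> X}, forall z, f (h z) = g z.
Proof.
move=> gf; have [p [pker ker_p]] := field_projection (submodule_ker f).
have [|||h hE] := @linear_of_relation K Z X
  (fun z x => exists x', f x' = g z /\ x = x' - p x').
- move=> z; have [|x _ xz] := gf (g z); first by exists z.
  by exists (x - p x), x.
- move=> a z z' _ _ [x [xz ->]] [x' [xz' ->]]; exists (a *: x + x').
  by rewrite !linearP xz xz' scalerDr addrACA.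
- by move=> _ [x [fx ->]]; rewrite pker ?subrr //= fx linear0.
by exists h => z; have [x [xz ->]] := hE z; rewrite linearB ker_p subr0.
Qed.

End VectorSpaces.

(** * Dual numbers over a field *)

Section DualNumbers.
Variables (A : comNzRingType) (E : lmodType A) (e : E) (lam : {linear E -> A^o}).
Hypothesis A_field : is_field A.
Hypothesis lamK : forall v, lam v *: e = v.
Hypothesis lam_e : lam e = 1.

Local Notation R := (triv_ext E).
Let eps : R := (0, e).

(** An alias that bears the [A]-module structure along a |-> [(a, 0)], beside the given structure
    over R. *)
Definition restr_scalars (N : lmodType R) : Type := N.

Section RestrictScalars.
Variable N : lmodType R.

HB.instance Definition _ := GRing.Zmodule.on (restr_scalars N).

Let scale (a : A) (x : restr_scalars N) : restr_scalars N :=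
  ((a, 0) : R) *: (x : N).

Fact restr_scaleA a b x : scale a (scale b x) = scale (a * b) x.
Proof.
rewrite /scale scalerA; congr (_ *: _).
by apply: injective_projections; rewrite //= !scaler0 addr0.
Qed.

Fact restr_scale1 : left_id 1 scale.
Proof. by move=> x; apply: scale1r. Qed.

Fact restr_scaleDr : right_distributive scale +%R.
Proof. by move=> a x y; apply: scalerDr. Qed.

Fact restr_scaleDl x : {morph scale^~ x : a b / a + b}.
Proof.
move=> a b; rewrite /scale -scalerDl; congr (_ *: _).
by apply: injective_projections; rewrite //= addr0.
Qed.

HB.instance Definition _ := GRing.Zmodule_isLmodule.Build A (restr_scalars N)
  restr_scaleA restr_scale1 restr_scaleDr restr_scaleDl.

End RestrictScalars.

Lemma restr_scaleE (N : lmodType R) (a : A) (x : restr_scalars N) :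
  a *: x = ((a, 0) : R) *: (x : N).
Proof. by []. Qed.

(** As [lam] is the coordinate along [e], r = [(r.1, 0) + (lam r.2, 0) * eps]: an R-module is an
    [A]-module with a square-zero operator [eps]. *)
Lemma triv_ext_scaleE (N : lmodType R) (r : R) (x : N) :
  r *: x = ((r.1, 0) : R) *: x + ((lam r.2, 0) : R) *: (eps *: x).
Proof.
rewrite scalerA -scalerDl; congr (_ *: _); apply: injective_projections.
  by rewrite /= mulr0 addr0.
by rewrite /= lamK scaler0 addr0 add0r.
Qed.

Lemma eps_eps (N : lmodType R) (x : N) : eps *: (eps *: x) = 0.
Proof.
rewrite scalerA; suff -> : eps * eps = 0 by rewrite scale0r.
by apply: injective_projections; rewrite /= ?mulr0 // scale0r addr0.
Qed.

Lemma eps_scalar (N : lmodType R) (a : A) (x : N) :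
  eps *: (((a, 0) : R) *: x) = ((a, 0) : R) *: (eps *: x).
Proof. by rewrite !scalerA mulrC. Qed.

Lemma restr_linear (M N : lmodType R) (f : {linear M -> N}) :
  exists g : {linear restr_scalars M -> restr_scalars N}, g =1 f.
Proof. by apply: ex_linear => a u v _ _; apply: linearP. Qed.

Lemma ex_linear_triv_ext (M N : lmodType R)
    (f : {linear restr_scalars M -> restr_scalars N}) :
  (forall x, f (eps *: (x : M)) = eps *: (f x : N)) ->
  exists g : {linear M -> N}, g =1 f.
Proof.
move=> feps; apply: ex_linear => r u v _ _.
by rewrite triv_ext_scaleE -!restr_scaleE !linearD !linearZ feps -triv_ext_scaleE.
Qed.

(* The induced module R (x)_A V, where [(x, y)] stands for x + eps y. *)
Definition induced (V : lmodType A) : Type := (V * V)%type.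

Section Induced.
Variable V : lmodType A.

HB.instance Definition _ := GRing.Zmodule.on (induced V).

Let scale (r : R) (x : induced V) : induced V :=
  (r.1 *: x.1, r.1 *: x.2 + lam r.2 *: x.1).

Fact induced_scaleA r s x : scale r (scale s x) = scale (r * s) x.
Proof.
apply: injective_projections; rewrite /= scalerA //.
have -> : lam (r.1 *: s.2 + s.1 *: r.2) = r.1 * lam s.2 + s.1 * lam r.2.
  by rewrite linearD !linearZ.
by rewrite scalerDl scalerDr !scalerA -addrA (mulrC (lam r.2)).
Qed.

Fact induced_scale1 : left_id 1 scale.
Proof.
move=> x; apply: injective_projections; rewrite /= scale1r //.
by rewrite linear0 scale0r addr0.
Qed.

Fact induced_scaleDr : right_distributive scale +%R.
Proof.
by move=> r x y; apply: injective_projections; rewrite /= !scalerDr // addrACA.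
Qed.

Fact induced_scaleDl x : {morph scale^~ x : r s / r + s}.
Proof.
move=> r s; apply: injective_projections; rewrite /= scalerDl //.
by rewrite linearD scalerDl addrACA.
Qed.

HB.instance Definition _ := GRing.Zmodule_isLmodule.Build R (induced V)
  induced_scaleA induced_scale1 induced_scaleDr induced_scaleDl.

Lemma induced_scaleE (r : R) (x : induced V) :
  r *: x = (r.1 *: x.1, r.1 *: x.2 + lam r.2 *: x.1).
Proof. by []. Qed.

Lemma induced_scalarE (a : A) (x : induced V) :
  ((a, 0) : R) *: x = (a *: x.1, a *: x.2).
Proof. by rewrite induced_scaleE /= linear0 scale0r addr0. Qed.

Lemma induced_epsE (x : induced V) : eps *: x = (0, x.1).
Proof. by rewrite induced_scaleE /= !scale0r lam_e scale1r add0r. Qed.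

(** An R-linear map on the induced module amounts to an [A]-linear map on the first factor. The
    latter has a lift [h0] over the field, and (x, y) |-> h0 x + eps h0 y lifts the former. *)
Lemma projective_induced : projective (induced V : lmodType R).
Proof.
move=> M N p g pT.
have [p' p'E] := restr_linear p.
have [|g0 g0E] := @ex_linear A V (restr_scalars N) (fun x => g ((x, 0) : induced V)).
  move=> a u v _ _; rewrite restr_scaleE -linearP induced_scalarE.
  by congr (g (_, _)); rewrite /= scaler0 addr0.
have [|h0 h0E] := field_lift A_field (f := p') (g := g0).
  move=> _ [x _ <-]; have [y _ yx] : range p (g0 x : N) by rewrite pT.
  by exists y; rewrite ?p'E.
have [|h1 h1E] := @ex_linear A (restr_scalars (induced V)) (restr_scalars M)
    (fun x => h0 (x : induced V).1
              + (eps *: (h0 (x : induced V).2 : M) : restr_scalars M)).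
  move=> a u v _ _; rewrite [a *: u]restr_scaleE induced_scalarE /= !linearP /=.
  by rewrite [in RHS]scalerDr addrACA.
have [|h hE] := ex_linear_triv_ext (f := h1).
  move=> x; rewrite !h1E induced_epsE /= linear0 add0r scalerDr.
  by rewrite eps_eps addr0.
exists h => -[x y]; rewrite hE h1E /= linearD linearZ -!p'E !h0E !g0E.
rewrite -linearZ -linearD induced_epsE; congr (g (_, _)).
  by rewrite addr0.
by rewrite add0r.
Qed.

End Induced.


Section Periodic.
Variable N : lmodType R.

Local Notation P := (induced (restr_scalars N)).

(* The surjection R (x)_A N -> N sending (x, y) to x + s eps y has as kernel the
   twist of N by eps |-> - eps, so the sign [s] alternates in the resolution. *)
Definition periodic_fun (s : R) (x : P) : P :=
  (s *: (eps *: (x.1 : N)), (x.1 : N) + s *: (eps *: (x.2 : N))).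

Fact periodic_fun_linear s : linear (periodic_fun s).
Proof.
have sC (a : A) (x : N) :
    s *: (eps *: (((a, 0) : R) *: x)) = ((a, 0) : R) *: (s *: (eps *: x)).
  by rewrite eps_scalar !scalerA (mulrC s).
move=> r u v; apply: injective_projections; rewrite /periodic_fun /=.
  by rewrite !restr_scaleE !scalerDr sC.
by rewrite !restr_scaleE !scalerDr !sC -[in RHS](addrA (_ *: u.1)) [RHS]addrACA.
Qed.

HB.instance Definition _ s := GRing.isLinear.Build R P P *:%R (periodic_fun s)
  (@periodic_fun_linear s).

Definition periodic (s : R) : {linear P -> P} := periodic_fun s.

Lemma periodic_exact s : exact (periodic s) (periodic (- s)).
Proof.
have eps0 (x : N) : eps *: (s *: (eps *: x)) = 0.
  by rewrite scalerA mulrC -scalerA eps_eps scaler0.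
apply/seteqP; split=> [_ [[x y] _ <-]|[x y] /= [_ /eqP]].
  apply: injective_projections; rewrite /= /periodic_fun /=.
    by rewrite eps0 scaler0.
  by rewrite !scalerDr eps0 scaler0 addr0 scaleNr subrr.
(* A pair in the kernel has [x] equal to [s] times eps y, so it is the image of [(y, 0)]. *)
rewrite scaleNr subr_eq0 => /eqP ->; exists (y, 0) => //.
by apply: injective_projections; rewrite /= /periodic_fun /= ?scaler0 ?addr0.
Qed.

(* Projective modules over R are also injective: they are summands of induced
   modules, and a map into [induced V] is determined by its second component,
   which is an arbitrary [A]-linear map into [V]. *)
Lemma projective_extension (M L Q : lmodType R) (f : {linear M -> L})
    (phi : {linear M -> Q}) :
  projective Q -> (forall x, f x = 0 -> phi x = 0) ->
  exists psi : {linear L -> Q}, forall x, psi (f x) = phi x.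
Proof.
move=> projQ f_phi.
pose I : lmodType R := induced (restr_scalars Q).
have [|tau tauE] := @ex_linear R I Q (fun z => (z.1 : Q) + eps *: (z.2 : Q)).
  move=> r u v _ _ /=; rewrite [r *: (_ + _)]triv_ext_scaleE !restr_scaleE !scalerDr.
  rewrite !eps_scalar eps_eps scaler0 addr0.
  by rewrite -[in RHS](addrA (_ *: u.1)) [RHS]addrACA.
(* Projectivity splits the surjection [tau], so it is enough to extend [sigma \o phi]. *)
have [|sigma sigmaK] := projQ I Q tau idfun.
  apply/seteqP; split=> // x _; exists ((x, 0) : I) => //.
  by rewrite tauE /= scaler0 addr0.
have [f' f'E] := restr_linear f.
have [|phi2 phi2E] := @ex_linear A (restr_scalars M) (restr_scalars Q)
    (fun x => (sigma (phi x) : I).2).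
  by move=> a u v _ _; rewrite restr_scaleE !linearP /= linear0 scale0r addr0.
have [|h hE] := field_extension A_field (f := f') (g := phi2).
  by move=> x; rewrite f'E phi2E => /f_phi ->; rewrite linear0.
(* R-linearity forces the first component at z to be the second component at eps z. *)
have [|psi psiE] := @ex_linear R L I (fun z => (h (eps *: z), h z)).
  have hD x y : h (x + y : L) = h x + h y := linearD h x y.
  have hZ r (x : L) : h (r *: x) = r.1 *: h x + lam r.2 *: h (eps *: x).
    by rewrite [r *: x]triv_ext_scaleE hD -!restr_scaleE !linearZ_LR.
  move=> r u v _ _; apply: injective_projections; rewrite /= ?scalerDr hD.
    rewrite scalerA mulrC -scalerA hZ eps_eps.
    by rewrite [h 0]linear0 scaler0 addr0.
  by rewrite hZ.
exists (tau \o psi) => x; rewrite -[RHS]sigmaK /= psiE; congr (tau _).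
apply: injective_projections => /=; last by rewrite -f'E hE phi2E.
by rewrite -linearZ_LR -f'E hE phi2E !linearZ_LR induced_epsE.
Qed.

End Periodic.

Lemma all_Gorenstein_projective (N : lmodType R) : Gorenstein_projective N.
Proof.
pose I : lmodType R := induced (restr_scalars N).
(* The absolute value keeps the signs alternating across negative indices. *)
pose sg (i : int) : R := (-1) ^+ `|i|%N.
have sgS i : sg (i + 1) = - sg i.
  case: i => n; rewrite /sg; first by rewrite -PoszD addn1 /= exprS mulN1r.
  have -> : Negz n + 1 = - (n%:Z) by rewrite NegzE -addn1 PoszD opprD addrNK.
  by rewrite abszN /= exprS mulN1r opprK.
have sg0 : sg 0 = 1 by rewrite /sg expr0.
exists (fun=> I), (fun i => periodic N (sg i)); split.
- by move=> _; apply: projective_induced.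
- by move=> i; rewrite sgS; apply: periodic_exact.
(* The map at index 0 sends (a, b) to (eps a, a + eps b), which has the form (eps x, x) for x = a +
   eps b; such pairs form a copy of [N]. *)
- have [|iota iotaE] := @ex_linear R N I (fun x => (eps *: x, x)).
    move=> r u v _ _; rewrite induced_scaleE /=; apply: injective_projections => /=.
      rewrite scalerDr scalerA mulrC -scalerA [r *: _]triv_ext_scaleE eps_eps.
      by rewrite scaler0 addr0.
    by rewrite [r *: u]triv_ext_scaleE.
  exists iota; split; first by move=> x y; rewrite !iotaE => -[].
  rewrite sg0; apply/seteqP; split=> [_ [x _ <-]|_ [[x y] _ <-]].
    exists (x, 0) => //; rewrite iotaE.
    apply: injective_projections; rewrite /= /periodic_fun /= scale1r //.
    by rewrite !scaler0 addr0.
  exists (x + eps *: y) => //; rewrite iotaE.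
  apply: injective_projections; rewrite /= /periodic_fun /= !scale1r //.
  by rewrite scalerDr eps_eps addr0.
- move=> Q projQ i phi; rewrite sgS; split=> [phi0|[psi psiE] x]; last first.
    have : range (periodic N (sg i)) (periodic N (sg i) x) by exists x.
    by rewrite periodic_exact psiE => ->; rewrite linear0.
  have [|psi psiE] :=
      projective_extension (f := periodic N (- sg i)) (phi := phi) projQ.
    move=> x x0; have : range (periodic N (sg i)) x by rewrite periodic_exact.
    by case=> y _ <-; apply: phi0.
  by exists psi => x; rewrite psiE.
Qed.

End DualNumbers.

(** * Dimension zero, and the theorem *)

Lemma Gproj_resolution0 (S : comNzRingType) (N : lmodType S) :
  Gorenstein_projective N -> Gproj_resolution N 0.
Proof.
move=> GPN; pose Z : lmodType S := 'rV[S]_0.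
have Z0 (x : Z) : x = 0 by apply/rowP => -[].
pose G (i : nat) : lmodType S := if i is 0 then N else Z.
exists G, (fun i => \0), idfun; split=> //.
- by move=> [].
- by move=> [|i] // _ x; apply: Z0.
- by apply/seteqP; split=> // x _; exists x.
- by apply/seteqP; split=> [_ [x _ <-] //|x /= ->]; exists 0.
- by move=> i; apply/seteqP; split=> [_ [x _ <-] //|x _]; exists 0; rewrite ?(Z0 x).
Qed.

Lemma least0 (P : set nat) : P 0 -> least P = Fin 0.
Proof. by move=> /least_le; case: least => [[]|]. Qed.

Lemma Ggldim0 (S : comNzRingType) :
  (forall N : lmodType S, Gorenstein_projective N) -> Ggldim S = Fin 0.
Proof.
move=> GP; apply: least0 => N.
by rewrite /Gpd least0 //; apply: Gproj_resolution0.
Qed.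

Theorem theorem3p1 (A : comNzRingType) (m : {pred A}) (E : lmodType A)
    (A_local : local_ring m)
    (mE0 : forall (a : A) (e : E), a \in m -> a *: e = 0)
    (E_neq0 : exists e : E, e != 0) :
  (noetherian A -> ~ is_field A -> finitely_generated E ->
     Ggldim (triv_ext E) = Infinity)
  /\
  (perfect_ring A ->
     (Ggldim (triv_ext E) = Infinity \/ Ggldim (triv_ext E) = Fin 0)
     /\
     (Ggldim (triv_ext E) = Fin 0 ->
        is_field A /\ inhabited (Vector.axiom 1 E))).
Proof.
have [e e_neq0] := E_neq0.
(* An element of [A] either lies in [m] and kills [E], or is a unit; so the line through [e] is a
   direct summand. *)
have [||pi [pi_e pi_line]] :=
    @semisimple_projection A E [set v | exists c, v = c *: e].
- move=> a; have [am|/(local_unit A_local)[b ba]] := boolP (a \in m).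
    by left=> v; apply: mE0.
  by right; exists b => v; rewrite scalerA ba scale1r.
- split=> [|a _ _ [c ->] [c' ->]]; first by exists 0; rewrite scale0r.
  by exists (a * c + c'); rewrite scalerDl scalerA.
have {}pi_e : pi e = e by apply: pi_e; exists 1; rewrite scale1r.
(* Finite dimension makes [e] a basis of [E] over a field, with coordinate [lam]; both parts follow
   from this. *)
have rigid n : Ggldim (triv_ext E) = Fin n ->
    is_field A /\
    exists lam : {linear E -> A^o}, (forall v, lam v *: e = v) /\ lam e = 1.
  move=> /(finite_Ggldim_rigid A_local mE0 e_neq0 pi_e pi_line)[A_field e_gen].
  split=> //; have ce0 (c : A) : c *: e = 0 -> c = 0.
    move=> ce; apply/eqP; apply: contraT => /A_field[b cb].
    by case/eqP: e_neq0; rewrite -[e]scale1r -cb mulrC -scalerA ce scaler0.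
  have [|||lam lamK] := @linear_of_relation A E A^o (fun v c => c *: e = v).
  - by move=> v; have [c ->] := e_gen v; exists c.
  - by move=> a _ _ c c' <- <-; rewrite scalerDl scalerA.
  - by move=> c /ce0.
  exists lam; split=> //; apply/eqP; rewrite -subr_eq0; apply/eqP/ce0.
  by rewrite scalerBl lamK scale1r subrr.
split=> [_ A_nonfield _|_].
  case E_dim : (Ggldim _) => [n|] //.
  by have [] := rigid n E_dim.
split.
  case E_dim : (Ggldim _) => [n|]; [right | by left].
  have [A_field [lam [lamK lam_e]]] := rigid n E_dim.
  (* The ring is now that of dual numbers over a field, so any finite value is 0. *)
  by rewrite -E_dim; apply: Ggldim0; apply: all_Gorenstein_projective lamK lam_e.
move=> /rigid[A_field [lam [lamK lam_e]]]; split=> //; constructor.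
exists (fun v => \row_(i < 1) lam v).
  by move=> a u v; apply/rowP => i; rewrite !mxE linearP.
exists (fun r : 'rV[A]_1 => r 0 0 *: e) => [v|r]; first by rewrite mxE lamK.
by apply/rowP => i; rewrite mxE linearZ_LR lam_e [LHS]mulr1 ord1.
Qed.
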